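(* Let $(S,d)$ be a $k$-center instance with $|S|=n$, optimal radius $r^*$ and optimal clusters $C_1,\dots,C_k$, let $\epsilon>0$, and suppose every optimal cluster has size greater than $2\epsilon n$ and at least three optimal clusters are $(3,\epsilon)$-locally perturbation resilient. Then for every pair of distinct $(3,\epsilon)$-locally perturbation resilient clusters $C_i,C_j$ and all $u\in C_i$, $v\in C_j$, we have $d(u,v)>r^*$.
   Context: A $k$-center instance is a finite set $S$ with a metric $d$; for $X\subseteq S$, $|X|=k$, the cost is $\max_{v\in S}\min_{x\in X}d(v,x)$, $r^*$ is the minimum cost, and the clustering induced by $X$ is the Voronoi partition (each point assigned to its closest center). An $\alpha$-perturbation of $d$ is any $d':S\times S\to\mathbb{R}_{\ge0}$ with $d(u,v)\le d'(u,v)\le\alpha d(u,v)$ for all $u,v$ (not necessarily a metric). Two sets $A,B$ are $\epsilon$-close if $|A\setminus B|+|B\setminus A|\le\epsilon n$. An optimal cluster $C_i$ is $(\alpha,\epsilon)$-locally perturbation resilient if for every $\alpha$-perturbation $d'$, the optimal $k$-center clustering under $d'$ contains a cluster that is $\epsilon$-close to $C_i$. *)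

(* Defs.v *)
From HB Require Import structures.
From mathcomp Require Import all_boot all_order all_algebra.
From mathcomp Require Import reals.

Set Implicit Arguments.
Unset Strict Implicit.
Unset Printing Implicit Defensive.

Import Order.TTheory GRing.Theory Num.Theory.
Local Open Scope ring_scope.

Definition is_metric (R : realType) (S : finType) (d : S -> S -> R) : Prop :=
  [/\ forall x y, 0 <= d x y,
      forall x y, d x y = 0 <-> x = y,
      forall x y, d x y = d y x
    & forall x y z, d x z <= d x y + d y z].

(* The fold starts from an upper bound of the values, which does not affect
   the minimum of a nonempty family (see [minvalP]); R has no top element to
   start from. *)
Definition minval (R : realType) (I : finType) (P : pred I) (F : I -> R) : R :=
  \big[Order.min/ \big[Order.max/0]_(i | P i) F i]_(i | P i) F i.

Lemma minvalP (R : realType) (I : finType) (P : pred I) (F : I -> R) (i0 : I) :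
  P i0 ->
  (exists2 i, P i & minval P F = F i) /\ (forall i, P i -> minval P F <= F i).
Proof.
move=> Pi0; split; last by move=> i Pi; apply: bigmin_le_cond.
case: (arg_minP F Pi0) => i Pi min_i; exists i => //.
apply/le_anti/andP; split; first exact: bigmin_le_cond.
by apply: le_bigmin => //; apply: le_bigmax_cond.
Qed.

(* The functions below do not assume that [d] is a metric, since they are also
   applied to perturbations; [d v x] is read with [v] a point, [x] a center. *)
Definition cost (R : realType) (S : finType) (d : S -> S -> R)
    (X : {set S}) : R :=
  \big[Order.max/0]_(v : S) minval [pred x | x \in X] (d v).

Definition opt_radius (R : realType) (S : finType) (d : S -> S -> R)
    (k : nat) : R :=
  minval [pred X : {set S} | #|X| == k] (cost d).

Definition optimal_centers (R : realType) (S : finType) (d : S -> S -> R)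
    (k : nat) (X : {set S}) : Prop :=
  #|X| = k /\ cost d X = opt_radius d k.

(* [f] assigns each point to a closest center, with ties broken arbitrarily. *)
Definition closest_assignment (R : realType) (S : finType) (d : S -> S -> R)
    (X : {set S}) (f : S -> S) : Prop :=
  forall v, f v \in X /\ forall x, x \in X -> d v (f v) <= d v x.

Definition induced_clustering (R : realType) (S : finType) (d : S -> S -> R)
    (X : {set S}) (C : {set {set S}}) : Prop :=
  exists2 f : S -> S, closest_assignment d X f
    & C = [set [set v | f v == x] | x in X].

Definition optimal_clustering (R : realType) (S : finType) (d : S -> S -> R)
    (k : nat) (C : {set {set S}}) : Prop :=
  exists2 X : {set S}, optimal_centers d k X & induced_clustering d X C.

Definition perturbation (R : realType) (S : finType) (alpha : R)
    (d d' : S -> S -> R) : Prop :=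
  forall u v, 0 <= d' u v /\ d u v <= d' u v <= alpha * d u v.

Definition eps_close (R : realType) (S : finType) (eps : R)
    (A B : {set S}) : Prop :=
  (#|A :\: B| + #|B :\: A|)%:R <= eps * #|S|%:R.

(* Optimal clusterings under [d'] need not be unique; each of them must contain
   a cluster close to [A]. *)
Definition locally_perturbation_resilient (R : realType) (S : finType)
    (d : S -> S -> R) (k : nat) (alpha eps : R) (A : {set S}) : Prop :=
  forall d' : S -> S -> R, perturbation alpha d d' ->
  forall C' : {set {set S}}, optimal_clustering d' k C' ->
  exists2 B : {set S}, B \in C' & eps_close eps A B.

(* Main.v *)
(* The perturbation may triple every distance, except that a distance of at
   least the optimal radius r must become at least 3r. Hence every set X of k
   centers that covers all points within 3r is optimal for some perturbation,
   and a point can be sent to any center closer than r that is at most three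
   times as far as the nearest one; without a center closer than r, to any
   center within 3r. A resilient cluster is recovered for all these choices,
   so a single center x of X receives a fixed majority of it: a point of that
   majority is closer than r to x and more than three times farther from each
   center closer than r.

   If u and v are at distance at most r, then u serves both clusters within 3r,
   and together with one point of each other cluster this leaves one center
   free. So one of the two clusters A, say, is mostly within r of a point
   outside the two clusters. Two such outside points for the same A cannot
   exist: adding both as centers, the one preferred by A has points of A much
   closer to it than the other, and replacing centers by such points produces
   ever closer pairs of points, which is absurd in a finite set. Hence the free
   center and the points of the other clusters can be chosen so that neither of
   the two clusters is recovered. Only if at most one error is allowed can there
   be too few points for this choice, but then one can place more centers in a
   single cluster than its recovery tolerates. *)

Require Import Defs.
From mathcomp Require Import all_boot all_order all_algebra.
From mathcomp Require Import reals.
From mathcomp Require Import zify lra.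

Set Implicit Arguments.
Unset Strict Implicit.
Unset Printing Implicit Defensive.

Import Order.TTheory GRing.Theory Num.Theory.
Local Open Scope ring_scope.

(** * Common points of two large parts of a set *)

Lemma setI_witness (S : finType) (A W1 W2 : {set S}) :
  W1 \subset A -> W2 \subset A -> (#|A| < #|W1| + #|W2|)%N ->
  exists2 w, w \in W1 & w \in W2.
Proof.
move=> sW1 sW2 ltA; have /card_gt0P[w] : (0 < #|W1 :&: W2|)%N.
  have := cardsUI W1 W2.
  have : (#|W1 :|: W2| <= #|A|)%N by apply: subset_leq_card; rewrite subUset sW1.
  lia.
by rewrite inE => /andP[w1 w2]; exists w.
Qed.

Lemma setI_witness_neq (S : finType) (A W1 W2 : {set S}) (y : S) :
  W1 \subset A -> W2 \subset A -> (#|A|.+1 < #|W1| + #|W2|)%N ->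
  exists w, [/\ w \in W1, w \in W2 & w != y].
Proof.
move=> sW1 sW2 ltA; have [||w] := @setI_witness _ A (W1 :\ y) W2 _ sW2.
- by rewrite (subset_trans _ sW1) // subsetDl.
- have := cardsD1 y W1; case: (y \in W1) => /=; lia.
by rewrite !inE => /andP[wy w1] w2; exists w.
Qed.

(** Here [c] is the size of a cluster and [e] the number of errors. A recovering cell keeps at least
    [c - e] points of the cluster, and [c.+1 - e] once it also holds an outside point, which uses up
    one error. *)
Lemma majority_weak (c e m : nat) : (c.+1 - e <= m -> c - e <= m)%N.
Proof. lia. Qed.

Lemma majority_gt0 (c e m : nat) : (2 * e < c -> c - e <= m -> 0 < m)%N.
Proof. lia. Qed.

Lemma majority_sum (c e m m' : nat) :
  (2 * e < c -> c - e <= m -> c.+1 - e <= m' -> c.+1 < m + m')%N.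
Proof. lia. Qed.

(** * Assignments realized by perturbations, and the points they force *)

Section ForcedAssignments.

Variables (R : realType) (S : finType) (d : S -> S -> R) (k e : nat) (r : R).
Hypothesis d_ge0 : forall x y, 0 <= d x y.
Hypothesis d_refl : forall x, d x x = 0.
Hypothesis d_sep : forall x y, x != y -> 0 < d x y.
Hypothesis d_sym : forall x y, d x y = d y x.
Hypothesis d_tri : forall x y z, d x z <= d x y + d y z.
Hypothesis r_gt0 : 0 < r.
Implicit Types (A X : {set S}) (g : S -> S) (a b f o w x y z : S).

(* Some perturbation that leaves [X] optimal assigns [w] to [x]. *)
Definition allowed (X : {set S}) (w x : S) : bool :=
  (x \in X) &&
  ([&& d w x < r & [forall y in X, d w x <= 3 * d w y]] ||
   [forall y in X, r <= d w y] && (d w x <= 3 * r)).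

Definition assignment (X : {set S}) (g : S -> S) : Prop :=
  forall w, allowed X w (g w).

Definition cell (g : S -> S) (x : S) : {set S} := [set w | g w == x].

(** Resilience with perturbations replaced by the assignments they realize and the real error bound
    by an integer; [locally_resilient_assignments] derives it. *)
Definition resilient (A : {set S}) : Prop :=
  forall (X : {set S}) (g : S -> S), #|X| = k -> assignment X g ->
  exists2 x, x \in X & (#|A :\: cell g x| + #|cell g x :\: A| <= e)%N.

(* [x] is the only center of [X] to which [w] may be assigned. *)
Definition forced (X : {set S}) (w x : S) : bool :=
  (d w x < r) &&
  [forall f in X, (f != x) ==> (r <= d w f) || (3 * d w x < d w f)].

Definition forced_to (A X : {set S}) (x : S) : {set S} :=
  [set w in A | forced X w x].

Definition ball (A : {set S}) (x : S) : {set S} := [set w in A | d w x < r].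

Definition covers (X : {set S}) : Prop :=
  forall w, exists2 y, y \in X & d w y <= 3 * r.

Lemma allowed_near X w x : x \in X -> d w x < r ->
  (forall y, y \in X -> d w x <= 3 * d w y) -> allowed X w x.
Proof.
move=> xX wx le3; rewrite /allowed xX wx /=; apply/orP; left.
by apply/forall_inP.
Qed.

Lemma allowed_far X w x : x \in X -> (forall y, y \in X -> r <= d w y) ->
  d w x <= 3 * r -> allowed X w x.
Proof.
move=> xX far le3; rewrite /allowed xX le3 andbT /=; apply/orP; right.
exact/forall_inP.
Qed.

Lemma allowed_cases X w x : allowed X w x -> x \in X /\
  ((d w x < r /\ forall y, y \in X -> d w x <= 3 * d w y) \/
   ((forall y, y \in X -> r <= d w y) /\ d w x <= 3 * r)).
Proof.
case/andP=> xX /orP[/andP[wx /forall_inP le3]|/andP[/forall_inP far le3]].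
  by split=> //; left.
by split=> //; right.
Qed.

Lemma allowed_center X x y : x \in X -> allowed X x y -> y = x.
Proof.
move=> xX /allowed_cases[yX [[_ le3]|[far _]]].
  apply/eqP; apply: contraT => neq; exfalso; have := le3 _ xX.
  by have := d_sep neq; rewrite (d_sym y x) d_refl; lra.
by exfalso; have := far _ xX; rewrite d_refl; have := r_gt0; lra.
Qed.

Lemma allowed_ex X w : covers X -> exists x, allowed X w x.
Proof.
move=> covX; have [y0 y0X y0le] := covX w.
case: (arg_minP (d w) y0X) => y yX ymin.
have [wy|wy] := ltP (d w y) r.
  exists y; apply: allowed_near => // z zX.
  by have := ymin z zX; have := d_ge0 w z; lra.
exists y; apply: allowed_far => //.
  by move=> z zX; exact: le_trans wy (ymin z zX).
exact: le_trans (ymin _ y0X) y0le.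
Qed.

Lemma assignment_ex X : covers X -> exists g, assignment X g.
Proof.
move=> covX; exists (fun w => odflt w [pick x | allowed X w x]) => w.
case: pickP => [x //|no]; have [x ax] := allowed_ex w covX.
by rewrite no in ax.
Qed.

(** The nearest center other than [x] works: [x] is at distance at least [r] from [w], or at least a
    third as far as this center, which is then closer than [r]. *)
Lemma allowed_alt X w x : ~~ forced X w x ->
  (exists y, [/\ y \in X, y != x & d w y <= 3 * r]) ->
  exists2 y, allowed X w y & y != x.
Proof.
move=> nf [y0 [y0X y0x y0le]].
have Py0 : [pred y | (y \in X) && (y != x)] y0 by rewrite /= y0X.
case: (arg_minP (d w) Py0) => y /andP[yX yx] ymin.
exists y => //.
have ymin' z : z \in X -> z != x -> d w y <= d w z.
  by move=> zX zx; apply: ymin; rewrite /= zX.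
case/nandP: nf => [wx|].
  rewrite -leNgt in wx; have [wy|wy] := ltP (d w y) r.
    apply: allowed_near => // z zX; have [->|zx] := eqVneq z x.
      by have := r_gt0; lra.
    by have := ymin' z zX zx; have := d_ge0 w z; lra.
  apply: allowed_far => // [z zX|]; last exact: le_trans (ymin' _ y0X y0x) _.
  by have [->//|zx] := eqVneq z x; apply: le_trans wy (ymin' z zX zx).
case/forall_inPn => f fX; rewrite negb_imply negb_or -ltNge -leNgt.
case/and3P=> fx wf lef; have yf := ymin' f fX fx.
apply: allowed_near => //; first exact: le_lt_trans yf wf.
move=> z zX; have [->|zx] := eqVneq z x; first exact: le_trans yf lef.
by have := ymin' z zX zx; have := d_ge0 w z; lra.
Qed.

Lemma forced_near X w x : forced X w x -> d w x < r.
Proof. by case/andP. Qed.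

Lemma forced_lt X w x f : forced X w x -> f \in X -> f != x ->
  d w f < r -> 3 * d w x < d w f.
Proof.
case/andP=> _ /forall_inP/[apply]/implyP/[apply]/orP[|//].
by rewrite leNgt => /negPf->.
Qed.

Lemma forced_toP A X x w : reflect (w \in A /\ forced X w x) (w \in forced_to A X x).
Proof. by rewrite inE; apply: andP. Qed.

Lemma forced_to_sub A X x : forced_to A X x \subset A.
Proof. by apply/subsetP=> w /forced_toP[]. Qed.

Lemma ballP A x w : reflect (w \in A /\ d w x < r) (w \in ball A x).
Proof. by rewrite inE; apply: andP. Qed.

Lemma ball_sub A x : ball A x \subset A.
Proof. by apply/subsetP=> w /ballP[]. Qed.

Lemma forced_to_ball A X x : (#|forced_to A X x| <= #|ball A x|)%N.
Proof.
apply: subset_leq_card; apply/subsetP=> w /forced_toP[wA /forced_near wx].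
exact/ballP.
Qed.

(* Moving one point at a time, the center that receives many points of [A]
   cannot change, because two different ones would need more than [#|A|]
   points; in the end all points that can leave it have left. *)
Lemma forced_majority (A X : {set S}) (kappa : S -> nat) : covers X ->
  (forall x w, x \in X -> w \in A ->
     exists y, [/\ y \in X, y != x & d w y <= 3 * r]) ->
  (forall g, assignment X g ->
     exists2 x, x \in X & (kappa x <= #|A :&: cell g x|)%N) ->
  (forall x y, x \in X -> y \in X -> x != y -> (#|A|.+1 < kappa x + kappa y)%N) ->
  exists2 x, x \in X & (kappa x <= #|forced_to A X x|)%N.
Proof.
move=> covX alts maj sep; have [g0 ag0] := assignment_ex covX.
have [x0 x0X le0] := maj g0 ag0.
pose alt w := odflt (g0 w) [pick y | allowed X w y && (y != x0)].
have altP w : w \in A -> ~~ forced X w x0 -> allowed X w (alt w) /\ alt w != x0.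
  move=> wA nf; rewrite /alt; case: pickP => [y /andP[]//|no].
  have [y ay yx] := allowed_alt nf (alts _ _ x0X wA).
  by have := no y; rewrite ay yx.
pose free w := (w \in A) && ~~ forced X w x0.
pose gl (l : seq S) w := if (w \in l) && free w then alt w else g0 w.
have agl l : assignment X (gl l).
  move=> w; rewrite /gl; case: ifP => [/andP[_ /andP[wA nf]]|_]; last exact: ag0.
  by have [] := altP w wA nf.
suff main l : (kappa x0 <= #|A :&: cell (gl l) x0|)%N.
  exists x0 => //; apply: leq_trans (main (enum S)) _; apply: subset_leq_card.
  apply/subsetP=> w; rewrite !inE /gl mem_enum /= => /andP[wA].
  rewrite wA; case: ifP => [fw|/negbT].
    by case/andP: (fw) => _ nf; have [_ /negPf->] := altP w wA nf.
  by rewrite /free wA negbK.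
elim: l => [|w l IHl]; first exact: leq_trans le0 _.
have [x xX lex] := maj _ (agl (w :: l)).
have [<-//|xx0] := eqVneq x x0.
(* Moving [w] alone adds at most one point to a cell; this is the successor in the separation
   hypothesis on [kappa]. *)
have lexl : (kappa x <= (#|A :&: cell (gl l) x|).+1)%N.
  apply: leq_trans lex _; apply: (@leq_trans #|w |: (A :&: cell (gl l) x)|).
    apply: subset_leq_card; apply/subsetP=> z; rewrite !inE /gl inE.
    by case: (eqVneq z w).
  by rewrite cardsU1; case: (w \notin _); lia.
have disj : (#|A :&: cell (gl l) x| + #|A :&: cell (gl l) x0| <= #|A|)%N.
  rewrite -cardsUI (_ : _ :&: _ :&: _ = set0).
    by rewrite cards0 addn0 subset_leq_card // subUset !subsetIl.
  apply/setP=> z; rewrite !inE; case: eqP => [->|]; rewrite ?andbF //.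
  by rewrite (negPf xx0) !andbF.
by have := sep _ _ xX x0X xx0; lia.
Qed.

(** * Majorities forced by resilience *)

Lemma cell_in (g : S -> S) A x : (#|A :&: cell g x| + #|A :\: cell g x| = #|A|)%N.
Proof. exact: cardsID. Qed.

Lemma cell_outsider (g : S -> S) A x o : o \notin A -> g o = x ->
  (0 < #|cell g x :\: A|)%N.
Proof. by move=> oA gox; apply/card_gt0P; exists o; rewrite !inE oA gox eqxx. Qed.

Lemma assignment_update X g o a : assignment X g -> allowed X o a ->
  assignment X (fun w => if w == o then a else g w).
Proof. by move=> ag ao w; case: eqP => [->|]. Qed.

Lemma cell_update A (g : S -> S) o a x : o \notin A ->
  A :&: cell (fun w => if w == o then a else g w) x = A :&: cell g x.
Proof.
move=> oA; apply/setP=> w; rewrite !inE.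
by case: (eqVneq w o) => // ->; rewrite (negPf oA).
Qed.

(** If the recovering center is not [b], its cell holds a point outside [A]: the center itself, or
    [o] rerouted to [a]. This leaves one error fewer for lost points of [A]. Taking [a = b] covers
    at most one center in [A]. *)
Lemma forced_majority_weak A X a b : resilient A -> (2 * e < #|A|)%N ->
  #|X| = k -> covers X ->
  (forall x w, x \in X -> w \in A ->
     exists y, [/\ y \in X, y != x & d w y <= 3 * r]) ->
  (forall y, y \in X -> y \in A -> y = a \/ y = b) ->
  (a != b -> exists2 o, o \notin A & allowed X o a) ->
  exists2 x, x \in X &
    ((if x == b then #|A| - e else #|A|.+1 - e) <= #|forced_to A X x|)%N.
Proof.
move=> resA cA cX covX alts XA out.
apply: (@forced_majority A X (fun x => if x == b then #|A| - e else #|A|.+1 - e)%N) => //.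
  move=> g ag; have [ab|ab] := eqVneq a b.
    have [x xX lex] := resA X g cX ag; exists x => //; have := cell_in g A x.
    case: eqP => [|/eqP xb]; first lia.
    have xA : x \notin A by apply/negP=> /(XA _ xX); rewrite ab => -[] /eqP; apply/negP.
    have := cell_outsider xA (allowed_center xX (ag x)); lia.
  have [o oA ao] := out ab; pose g1 w := if w == o then a else g w.
  have ag1 : assignment X g1 by apply: assignment_update.
  have [x xX lex] := resA X g1 cX ag1; exists x => //.
  have := cell_in g1 A x; rewrite /g1 cell_update // -/g1.
  case: eqP => [|/eqP xb]; first lia.
  suff : (0 < #|cell g1 x :\: A|)%N by lia.
  have [xA|xA] := boolP (x \in A).
    case: (XA _ xX xA) => [->|/eqP]; last by rewrite (negPf xb).
    by apply: (cell_outsider oA); rewrite /g1 eqxx.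
  exact: cell_outsider xA (allowed_center xX (ag1 x)).
move=> x y xX yX xy; case: eqP => [xb|_]; case: eqP => [yb|_]; try lia.
by rewrite xb yb eqxx in xy.
Qed.

(** Rerouting [o] to [a] gives the larger bound unless [b] recovers [A]; rerouting it to [b] does so
    unless [a] recovers [A]. Both exceptions together would need [2 * (#|A| - e)] points of [A], and
    moving [o] changes no count inside [A]. *)
Lemma forced_majority_strong A X a b o : resilient A -> (2 * e < #|A|)%N ->
  #|X| = k -> covers X ->
  (forall x w, x \in X -> w \in A ->
     exists y, [/\ y \in X, y != x & d w y <= 3 * r]) ->
  (forall y, y \in X -> y \in A -> y = a \/ y = b) ->
  a != b -> o \notin A -> allowed X o a -> allowed X o b ->
  exists2 x, x \in X & (#|A|.+1 - e <= #|forced_to A X x|)%N.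
Proof.
move=> resA cA cX covX alts XA ab oA oa ob.
apply: (@forced_majority A X (fun=> #|A|.+1 - e)%N) => //; last by lia.
move=> g ag.
have step c c' : c != c' -> allowed X o c ->
    (forall y, y \in X -> y \in A -> y = c \/ y = c') ->
    (exists2 x, x \in X & (#|A|.+1 - e <= #|A :&: cell g x|)%N) \/
    (#|A| - e <= #|A :&: cell g c'|)%N.
  move=> cc' oc XA'; pose g1 w := if w == o then c else g w.
  have ag1 : assignment X g1 by apply: assignment_update.
  have [x xX lex] := resA X g1 cX ag1.
  have := cell_in g1 A x; rewrite /g1 cell_update // -/g1 => cell_x.
  have [xc'|xc'] := eqVneq x c'; first by right; rewrite -xc'; lia.
  left; exists x => //.
  suff : (0 < #|cell g1 x :\: A|)%N by lia.
  have [xA|xA] := boolP (x \in A).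
    case: (XA' _ xX xA) => [->|/eqP]; last by rewrite (negPf xc').
    by apply: (cell_outsider oA); rewrite /g1 eqxx.
  exact: cell_outsider xA (allowed_center xX (ag1 x)).
have [//|leb] := step a b ab oa XA.
have [||//|lea] := step b a _ ob; first by rewrite eq_sym.
  by move=> y yX yA; have [] := XA y yX yA; [right|left].
have : (#|A :&: cell g a| + #|A :&: cell g b| <= #|A|)%N.
  rewrite -cardsUI (_ : _ :&: _ :&: _ = set0).
    by rewrite cards0 addn0 subset_leq_card // subUset !subsetIl.
  apply/setP=> z; rewrite !inE; case: eqP => [->|]; rewrite ?andbF //.
  by rewrite (negPf ab) !andbF.
lia.
Qed.

(** * Distances that exclude two forced choices for one point *)

Lemma forced_excl X Y w a b : forced X w a -> forced Y w b ->
  b \in X -> a \in Y -> a != b -> False.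
Proof.
move=> fa fb bX aY ab; have wa := forced_near fa; have wb := forced_near fb.
have ba : b != a by rewrite eq_sym.
have := forced_lt fa bX ba wb; have := forced_lt fb aY ab wa.
by have := d_ge0 w a; lra.
Qed.

(* If [w] is much closer to [y] than [y'] is, then [w] separates the points
   that prefer [y] to [y'] from [y']. *)
Lemma forced_swap_excl X Y v w y y' : forced X v y -> forced Y v y' ->
  y' \in X -> w \in Y -> y' != y -> w != y' ->
  2 * d w y < d y y' -> 2 * d w y < r -> False.
Proof.
have r0 := r_gt0.
move=> fy fy' y'X wY y'y wy' lt1 lt2; have vy := forced_near fy.
have vy' := forced_near fy'; have lt3 := forced_lt fy y'X y'y vy'.
have tri1 := d_tri v y w; rewrite (d_sym y w) in tri1.
have vw : d v w < r by lra.
have lt4 := forced_lt fy' wY wy' vw.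
have tri2 := d_tri y v y'; rewrite (d_sym y v) in tri2.
by have := d_ge0 v y; lra.
Qed.

(** For replacing a center [x] by a nearby [a]: a point forced to [x] before stays within [r] of
    [a], and too near to it for [f] to take the point over. *)
Lemma forced_drift_excl X Y v x f a l : forced X v x -> forced Y v f ->
  f \in X -> a \in Y -> f != x -> a != f ->
  d a x <= 2 * l -> 3 * l < r -> 2 * l <= d x f -> False.
Proof.
have r0 := r_gt0.
move=> fx ff fX aY fx' af lea ltl lef; have vx := forced_near fx.
have vf := forced_near ff; have lt3 := forced_lt fx fX fx' vf.
have tri1 := d_tri v x a; rewrite (d_sym x a) in tri1.
have va : d v a < r by lra.
have lt4 := forced_lt ff aY af va.
have tri2 := d_tri x v f; rewrite (d_sym x v) in tri2.
by have := d_ge0 v x; lra.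
Qed.

Lemma forced_gap v x y : 3 * d v x < d v y -> 2 * d v x < d x y.
Proof. by have := d_tri v x y; lra. Qed.

(** * Two outside centers near one cluster: the descent *)

Section Descent.

Variables (A F : {set S}) (x q : S).
Hypothesis resA : resilient A.
Hypothesis cA : (2 * e < #|A|)%N.
Hypothesis diamA : forall a b, a \in A -> b \in A -> d a b <= 2 * r.
Hypothesis cF : #|F|.+2 = k.
Hypothesis FA : forall f, f \in F -> f \notin A.
Hypothesis xF : x \notin F.
Hypothesis xA : x \notin A.
Hypothesis qF : q \notin F.
Hypothesis qA : q \notin A.
Hypothesis qx : q != x.
Hypothesis covx : covers (x |: F).
Hypothesis covw : forall w, w \in A -> d w x < r -> covers (w |: F).
Hypothesis qball : (#|A|.+1 - e <= #|ball A q|)%N.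

(** [F] holds the [k - 2] centers kept throughout the descent; only the other two vary. *)
Definition frame a b : {set S} := a |: (b |: F).

Hypothesis xmaj : (#|A|.+1 - e <= #|forced_to A (frame q x) x|)%N.

Let AF a : a \in A -> a \notin F.
Proof. by move=> aA; apply: contraTN aA => /FA. Qed.

Lemma frameP a b y : y \in frame a b -> [\/ y = a, y = b | y \in F].
Proof.
rewrite !inE => /or3P[/eqP->|/eqP->|yF]; [exact: Or31|exact: Or32|exact: Or33].
Qed.

Lemma frame1 a b : a \in frame a b. Proof. by rewrite !inE eqxx. Qed.
Lemma frame2 a b : b \in frame a b. Proof. by rewrite !inE eqxx orbT. Qed.
Lemma frame3 a b f : f \in F -> f \in frame a b.
Proof. by rewrite !inE => ->; rewrite !orbT. Qed.

Lemma frame_card a b : a != b -> a \notin F -> b \notin F -> #|frame a b| = k.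
Proof.
move=> ab aF bF.
by rewrite /frame !cardsU1 !inE (negPf ab) (negPf aF) bF -cF.
Qed.

Lemma frame_covers1 a b : covers (a |: F) -> covers (frame a b).
Proof.
move=> cov w; have [y yaF le] := cov w; exists y => //.
by move: yaF; rewrite !inE => /orP[->//|->]; rewrite !orbT.
Qed.

Lemma frame_covers2 a b : covers (b |: F) -> covers (frame a b).
Proof.
by move=> cov w; have [y yaF le] := cov w; exists y; rewrite // inE yaF orbT.
Qed.

Definition serves z := forall w, w \in A -> d w z <= 3 * r.

Lemma serves_in a : a \in A -> serves a.
Proof. by move=> aA w wA; have := diamA wA aA; have := r_gt0; lra. Qed.

Lemma serves_ball z : (0 < #|ball A z|)%N -> serves z.
Proof.
case/card_gt0P=> v /ballP[vA vz] w wA.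
by have := diamA wA vA; have := d_tri w v z; lra.
Qed.

Lemma frame_alts a b : a != b -> serves a -> serves b ->
  forall z w, z \in frame a b -> w \in A ->
  exists y, [/\ y \in frame a b, y != z & d w y <= 3 * r].
Proof.
move=> ab sa sb z w _ wA; have [az|az] := eqVneq a z.
  by exists b; rewrite frame2 -az eq_sym ab; split=> //; apply: sb.
by exists a; rewrite frame1 az; split=> //; apply: sa.
Qed.

Lemma x_ball : (#|A|.+1 - e <= #|ball A x|)%N.
Proof. exact: leq_trans xmaj (forced_to_ball _ _ _). Qed.

Lemma frame_majority_out y w : y \notin A -> y \notin F -> w \in A ->
  serves y -> covers (frame y w) ->
  exists2 z, z \in frame y w &
   ((if z == w then #|A| - e else #|A|.+1 - e) <= #|forced_to A (frame y w) z|)%N.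
Proof.
move=> yA yF wA sy cov; have yw : y != w by apply: contraNneq yA => ->.
apply: (@forced_majority_weak A (frame y w) w w) => //.
- by apply: frame_card => //; apply: AF.
- by apply: frame_alts => //; apply: serves_in.
- move=> z /frameP[->|->|/FA zA] zA'; [by rewrite zA' in yA|by left|].
  by rewrite zA' in zA.
by rewrite eqxx.
Qed.

(** The point [x], itself outside [A], can be sent to [a] and supplies the extra error there. No
    center in [F] wins, since it would take over points forced to [x] in [frame q x], against
    [forced_drift_excl]. *)
Lemma frame_majority_in l a b : a \in A -> b \in A -> a != b ->
  d a x <= 2 * l -> d b x <= 2 * l -> 3 * l < r ->
  (forall f, f \in F -> 2 * l <= d x f) -> d x a <= 3 * d x b ->
  exists2 z, z = a \/ z = b &
   ((if z == b then #|A| - e else #|A|.+1 - e) <= #|forced_to A (frame a b) z|)%N.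
Proof.
have r0 := r_gt0.
move=> aA bA ab da db ltl lF rat.
have cX : #|frame a b| = k by apply: frame_card => //; apply: AF.
have covX : covers (frame a b) by apply/frame_covers1/covw => //; lra.
have alts := frame_alts ab (serves_in aA) (serves_in bA).
have XA y : y \in frame a b -> y \in A -> y = a \/ y = b.
  by move=> /frameP[->|->|/FA yA] yA'; [left|right|rewrite yA' in yA].
have xa : allowed (frame a b) x a.
  apply: allowed_near; [exact: frame1| |].
    by rewrite d_sym; lra.
  move=> y /frameP[->|->|/lF yl]; [|exact: rat|].
    by have := d_ge0 x a; lra.
  by rewrite d_sym; have := d_ge0 x y; lra.
have [z /frameP zab zmaj] := forced_majority_weak resA cA cX covX alts XA
  (fun=> ex_intro2 _ _ x xA xa).
exists z => //; case: zab => [||zF]; [by left|by right|exfalso].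
have zb : z != b by apply: contraTneq zF => ->; apply: AF.
rewrite (negPf zb) in zmaj.
have [|v] := setI_witness (forced_to_sub A (frame a b) z) (forced_to_sub A (frame q x) x).
  exact: ltnW (majority_sum cA (majority_weak zmaj) xmaj).
case/forced_toP=> vA fz /forced_toP[_ fx].
apply: (@forced_drift_excl _ _ v x z b l fx fz) => //; last exact: lF.
- exact: frame3.
- exact: frame2.
- by apply: contraTneq zF => ->.
by rewrite eq_sym.
Qed.

(** Now [x] can be sent to either of [a] and [b], so the winner has the larger bound whichever it
    is. *)
Lemma frame_majority_in2 l a b : a \in A -> b \in A -> a != b ->
  d a x <= 2 * l -> d b x <= 2 * l -> 3 * l < r ->
  (forall f, f \in F -> 2 * l <= d x f) ->
  d x a <= 3 * d x b -> d x b <= 3 * d x a ->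
  exists2 z, z = a \/ z = b & (#|A|.+1 - e <= #|forced_to A (frame a b) z|)%N.
Proof.
have r0 := r_gt0.
move=> aA bA ab da db ltl lF rat rat'.
have al y : y \in frame a b -> d x y <= 3 * d x a -> d x y <= 3 * d x b ->
    d y x <= 2 * l -> allowed (frame a b) x y.
  move=> yX ya yb yl; apply: allowed_near => //; first by rewrite d_sym; lra.
  move=> z /frameP[->|->|/lF zl] //.
  by rewrite d_sym; have := d_ge0 x z; lra.
have x0 y : d x y <= 3 * d x y by have := d_ge0 x y; lra.
have cX : #|frame a b| = k by apply: frame_card => //; apply: AF.
have covX : covers (frame a b) by apply/frame_covers1/covw => //; lra.
have alts := frame_alts ab (serves_in aA) (serves_in bA).
have XA y : y \in frame a b -> y \in A -> y = a \/ y = b.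
  by move=> /frameP[->|->|/FA yA] yA'; [left|right|rewrite yA' in yA].
have xa := al a (frame1 a b) (x0 a) rat da.
have xb := al b (frame2 a b) rat' (x0 b) db.
have [z /frameP zab zmaj] := forced_majority_strong resA cA cX covX alts XA ab xA xa xb.
exists z => //; case: zab => [||zF]; [by left|by right|exfalso].
have [|v] := setI_witness (forced_to_sub A (frame a b) z) (forced_to_sub A (frame q x) x).
  exact: ltnW (majority_sum cA (majority_weak zmaj) xmaj).
case/forced_toP=> vA fz /forced_toP[_ fx].
apply: (@forced_drift_excl _ _ v x z b l fx fz) => //; last exact: lF.
- exact: frame3.
- exact: frame2.
- by apply: contraTneq zF => ->.
by apply: contraTneq zF => <-; apply: AF.
Qed.

Lemma frame_x_majority w : w \in A -> exists2 z, z = x \/ z = w &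
   ((if z == w then #|A| - e else #|A|.+1 - e) <= #|forced_to A (frame x w) z|)%N.
Proof.
move=> wA; have [||z /frameP zxw zmaj] := frame_majority_out xA xF wA.
- apply: serves_ball; exact: majority_gt0 cA (majority_weak x_ball).
- exact: frame_covers1.
exists z => //; case: zxw => [||zF]; [by left|by right|exfalso].
have zw : z != w by apply: contraTneq zF => ->; apply: AF.
rewrite (negPf zw) in zmaj.
have [|v] := setI_witness (forced_to_sub A (frame x w) z) (forced_to_sub A (frame q x) x).
  exact: ltnW (majority_sum cA (majority_weak zmaj) xmaj).
case/forced_toP=> vA fz /forced_toP[_ fx].
apply: (forced_excl fx fz); [exact: frame3|exact: frame1|].
by apply: contraTneq zF => <-.
Qed.

(* The last condition keeps the centers in [F] from taking [x] away from the
   points of [A] near [x] once [x] itself is not a center any more. *)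
Definition close w : bool :=
  [&& w \in A, (#|A| - e <= #|ball A w|)%N, 3 * d w x < r
    & [forall f in F, 2 * d w x <= d x f]].

(** The majority forced to [x] meets the ball around [q], and a common point [w] has
    [3 * d w x < d w q < r]. In [frame q w] the majority falls to [w], since any other center would
    take over points forced to [x]. *)
Lemma close_ex : exists w, close w.
Proof.
have r0 := r_gt0.
have [|w] := setI_witness (forced_to_sub A (frame q x) x) (ball_sub A q).
  exact: ltnW (majority_sum cA (majority_weak xmaj) qball).
case/forced_toP=> wA fw /ballP[_ wq]; exists w.
have lt3 := forced_lt fw (frame1 q x) qx wq.
have far f : f \in frame q x -> f != x -> 2 * d w x <= d x f.
  move=> fX fx; have [wf|wf] := ltP (d w f) r.
    exact/ltW/forced_gap/(forced_lt fw fX fx wf).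
  by have := d_tri w x f; lra.
apply/and4P; split=> //; [|by lra|]; last first.
  apply/forall_inP=> f fF; apply: far; first exact: frame3.
  by apply: contraTneq fF => ->.
have [||z /frameP zqw zmaj] := frame_majority_out qA qF wA.
- apply: serves_ball; exact: majority_gt0 cA (majority_weak qball).
- by apply/frame_covers2/covw => //; lra.
have [zw|zw] := eqVneq z w.
  by move: zmaj; rewrite zw eqxx => /leq_trans; apply; apply: forced_to_ball.
rewrite (negPf zw) in zmaj; exfalso.
have zX : z \in frame q x.
  by case: zqw => [->|/eqP|/frame3//]; [exact: frame1|rewrite (negPf zw)].
have zx : z != x.
  case: zqw => [->//|/eqP|]; first by rewrite (negPf zw).
  by apply: contraTneq => ->.
have [|v] := setI_witness (forced_to_sub A (frame q w) z) (forced_to_sub A (frame q x) x).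
  exact: ltnW (majority_sum cA (majority_weak zmaj) xmaj).
case/forced_toP=> vA fz /forced_toP[_ fx].
apply: (@forced_drift_excl _ _ v x z w (d w x) fx fz) => //.
- exact: frame2.
- by rewrite eq_sym.
- by have := d_ge0 w x; lra.
- by lra.
exact: far.
Qed.

(* The third condition lets [x] be assigned to either of [a] and [b], which then
   contains a point outside [A]; the fourth one bounds the drift away from [x]
   along the descent. *)
Definition close_pair l a b : bool :=
  [&& [&& a \in A, b \in A & a != b],
      (#|A| - e <= #|ball A a|)%N && (#|A| - e <= #|ball A b|)%N,
      (2 * d a b <= d x a) && (2 * d a b <= d x b)
    & (d a x + d a b <= 2 * l) && (d b x + d a b <= 2 * l)].

Lemma close_pairC l a b : close_pair l a b -> close_pair l b a.
Proof.
rewrite /close_pair (d_sym b a) (eq_sym b a).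
by case/and4P=> /and3P[-> -> ->] /andP[-> ->] /andP[-> ->] /andP[-> ->].
Qed.

(** A close point [w] nearest to [x] competes with [x] in [frame x w]. If [x] won, a point forced to
    [x] within [r] of [w] would be close and nearer to [x]. So [w] wins, and it is paired with a
    point forced to [w] within [r] of [x]. *)
Lemma close_pair_ex : exists l a b,
  [/\ 3 * l < r, forall f, f \in F -> 2 * l <= d x f & close_pair l a b].
Proof.
have r0 := r_gt0.
have [w0 w0c] := close_ex.
case: (arg_minP (fun w => d w x) w0c) => w /and4P[wA wb wr /forall_inP wF] wmin.
have wx : x != w by apply: contraTneq wA => <-.
have l_gt0 : 0 < d w x by rewrite d_sym d_sep.
have sw := forced_to_sub A (frame x w).
have [z zxw zmaj] := frame_x_majority wA.
case: zxw => zE; rewrite {z}zE ?(negPf wx) ?eqxx in zmaj; last first.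
  (* The extra unit in [x_ball] allows [v] to be chosen different from [w]. *)
  have [|v [/forced_toP[vA fv] /ballP[_ vx] vw]] :=
    setI_witness_neq w (sw w) (ball_sub A x).
    exact: majority_sum cA zmaj x_ball.
  have lt3 := forced_lt fv (frame1 x w) wx vx.
  have := forced_gap lt3; rewrite (d_sym w x) => ltv.
  exists (d w x), w, v; split=> //.
  have vb : (#|A| - e <= #|ball A v|)%N.
    have xv : x != v by apply: contraTneq vA => <-.
    have [z zxv zmaj'] := frame_x_majority vA.
    case: zxv => zE; rewrite {}zE ?(negPf xv) ?eqxx in zmaj'; last first.
      exact: leq_trans zmaj' (forced_to_ball _ _ _).
    have [|p /forced_toP[_ fw] /forced_toP[_ fx]] :=
      setI_witness (sw w) (forced_to_sub A (frame x v) x).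
      exact: ltnW (majority_sum cA zmaj zmaj').
    exfalso; apply: (@forced_swap_excl _ _ p v w x fw fx) => //.
    - exact: frame1.
    - exact: frame2.
    - by rewrite eq_sym.
    - by rewrite (d_sym w x).
    by rewrite (d_sym x w) in ltv; lra.
  apply/and4P; split; apply/andP; split=> //.
  - by rewrite vA eq_sym.
  - by rewrite (d_sym w v); lra.
  - by rewrite (d_sym w v) (d_sym x v); have := d_ge0 v w; lra.
  - by rewrite (d_sym w v); rewrite (d_sym x w) in ltv; lra.
  rewrite (d_sym w v); rewrite (d_sym x w) in ltv.
  by have := d_tri v w x; lra.
exfalso; have [|v] := setI_witness (sw x) (ball_sub A w).
  by rewrite addnC; exact: ltnW (majority_sum cA wb zmaj).
case/forced_toP=> vA fv /ballP[_ vw]; have wx' : w != x by rewrite eq_sym.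
have lt3 := forced_lt fv (frame2 x w) wx' vw.
have := forced_gap lt3; rewrite (d_sym x w) => ltv.
(* Here [v] is less than half as far from [x] as [w] is. *)
suff /wmin : close v by have := d_ge0 v x; lra.
apply/and4P; split=> //; [|by lra|]; last first.
  by apply/forall_inP=> f /wF; lra.
have vw' : v != w by apply: contraTneq ltv => ->; rewrite -leNgt; lra.
have [|||||z zvw zmaj'] := @frame_majority_in (d w x) v w vA wA vw'.
- by have := d_ge0 v x; lra.
- by lra.
- by [].
- exact: wF.
- by rewrite (d_sym x v) (d_sym x w); lra.
case: zvw => zE; rewrite {}zE ?(negPf vw') ?eqxx in zmaj'.
  exact: leq_trans (majority_weak zmaj') (forced_to_ball _ _ _).
exfalso; have [|p /forced_toP[_ fx] /forced_toP[_ fw]] :=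
  setI_witness (sw x) (forced_to_sub A (frame v w) w).
  by rewrite addnC; exact: ltnW (majority_sum cA zmaj' zmaj).
apply: (@forced_swap_excl _ _ p v x w fx fw) => //.
- exact: frame2.
- exact: frame1.
- by rewrite (d_sym x w).
by lra.
Qed.

(** If [a] wins in [frame a b], a point [w] forced to [a] within [r] of [b] has [2 * d w a < d a b].
    The halving keeps the drift bounded: [d w x + d w a] is at most [d a x + 2 * d w a], so the
    bound [2 * l] persists. *)
Lemma close_pair_step l a b : 3 * l < r ->
  (forall f, f \in F -> 2 * l <= d x f) -> close_pair l a b ->
  exists a' b', close_pair l a' b' /\ d a' b' < d a b.
Proof.
have r0 := r_gt0.
move=> ltl lF.
wlog amaj : a b / (#|A|.+1 - e <= #|forced_to A (frame a b) a|)%N => [main|].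
  move=> pab; case/and4P: (pab) => /and3P[aA bA ab] _ /andP[xa xb] /andP[la lb].
  have dab := d_ge0 a b.
  have [||||||z zab zmaj] := @frame_majority_in2 l a b aA bA ab => //.
  - by lra.
  - by lra.
  - by have := d_tri x b a; rewrite (d_sym b a); lra.
  - by have := d_tri x a b; lra.
  case: zab zmaj => -> zmaj; first exact: main.
  have frC : frame a b = frame b a by rewrite /frame setUCA.
  rewrite frC in zmaj; have [a' [b' [pab' lt]]] := main b a zmaj (close_pairC pab).
  by exists a', b'; rewrite (d_sym a b).
case/and4P=> /and3P[aA bA ab] /andP[ba bb] /andP[xa xb] /andP[la lb].
have dab := d_ge0 a b.
have sa := forced_to_sub A (frame a b) a.
have [|w [/forced_toP[wA fw] /ballP[_ wb] wa]] :=
  setI_witness_neq a sa (ball_sub A b).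
  by rewrite addnC; exact: majority_sum cA bb amaj.
have ba' : b != a by rewrite eq_sym.
have lt3 := forced_lt fw (frame2 a b) ba' wb.
have lt2 := forced_gap lt3.
have dwa := d_ge0 w a.
have wb' : w != b by apply: contraTneq lt2 => ->; rewrite (d_sym b a) -leNgt; lra.
have triw := d_tri x w a; have triw' := d_tri w a x; have triw2 := d_tri w a b.
have triw3 := d_tri x w b; have triw4 := d_tri x b w.
rewrite (d_sym b w) in triw4.
exists a, w; split; last by rewrite (d_sym a w); lra.
(* In [frame b w] the center [b] cannot win: it would take points forced to [a], although [w] is
   very close to [a]. *)
have wball : (#|A| - e <= #|ball A w|)%N.
  have bw : b != w by rewrite eq_sym.
  have [||||||z zbw zmaj] := @frame_majority_in2 l b w bA wA bw => //.
  - by lra.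
  - by lra.
  - by lra.
  - by lra.
  case: zbw zmaj => -> zmaj; last first.
    exact: leq_trans (majority_weak zmaj) (forced_to_ball _ _ _).
  have [|p /forced_toP[_ fa] /forced_toP[_ fb]] :=
    setI_witness sa (forced_to_sub A (frame b w) b).
    exact: ltnW (majority_sum cA (majority_weak amaj) zmaj).
  exfalso; apply: (@forced_swap_excl _ _ p w a b fa fb) => //.
  - exact: frame2.
  - exact: frame2.
  by rewrite (d_sym x a) in xa; lra.
rewrite /close_pair aA wA eq_sym wa ba wball (d_sym a w) /=.
by apply/andP; split; apply/andP; split; lra.
Qed.

Lemma descent_false : False.
Proof.
have [l [a [b [ltl lF pab]]]] := close_pair_ex.
have P0 : [pred p : S * S | close_pair l p.1 p.2] (a, b) by [].
case: (arg_minP (fun p : S * S => d p.1 p.2) P0) => -[a1 b1] /= p1 pmin.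
have [a2 [b2 [p2]]] := close_pair_step ltl lF p1.
by have := pmin (a2, b2) p2 => /=; lra.
Qed.

End Descent.

(** Every center is assigned to itself, so a cell holds at most one of the centers in [A] and misses
    more than [e] others. *)
Lemma too_many_centers A X : resilient A -> #|X| = k -> covers X ->
  (e.+1 < #|X :&: A|)%N -> False.
Proof.
move=> resA cX covX ltXA; have [g ag] := assignment_ex covX.
have [x xX lex] := resA X g cX ag.
have : (#|(X :&: A) :\ x| <= #|A :\: cell g x|)%N.
  apply: subset_leq_card; apply/subsetP=> y; rewrite !inE => /and3P[yx yX ->].
  by rewrite andbT (allowed_center yX (ag y)).
have := cardsD1 x (X :&: A); case: (x \in X :&: A) => /= *; lia.
Qed.

(* The successor accounts for [x], which lies outside [A] in all uses. *)
Definition central A x : bool := (#|A|.+1 - e <= #|ball A x|)%N.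

(** * Optimal clusters and the merging of two of them *)

Section Clusters.

Variables (K : {set S}) (home : S -> S).
Hypothesis cK : #|K| = k.
Hypothesis homeK : forall v, home v \in K.
Hypothesis home_id : forall c, c \in K -> home c = c.
Hypothesis home_le : forall v, d v (home v) <= r.

Definition cluster c : {set S} := [set v | home v == c].

Hypothesis cluster_large : forall c, c \in K -> (2 * e < #|cluster c|)%N.

Definition others ci cj : {set S} := K :\ ci :\ cj.

Definition transversal (h : S -> S) : Prop := forall c, c \in K -> home (h c) = c.

(** For a transversal [h] these are [k - 1] centers, which leaves one free: [u] alone serves the
    clusters of [ci] and [cj]. *)
Definition merged ci cj u (h : S -> S) : {set S} := u |: [set h c | c in others ci cj].

Lemma othersP ci cj c : reflect [/\ c \in K, c != ci & c != cj] (c \in others ci cj).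
Proof. by rewrite !inE; apply: (iffP and3P) => -[]. Qed.

Lemma clusterP c v : reflect (home v = c) (v \in cluster c).
Proof. by rewrite inE; apply: eqP. Qed.

Lemma cluster_diam c a b : a \in cluster c -> b \in cluster c -> d a b <= 2 * r.
Proof.
move=> /clusterP ha /clusterP hb; have := d_tri a c b.
by have := home_le a; have := home_le b; rewrite ha hb (d_sym b c); lra.
Qed.

Section Merge.

Variables (ci cj u : S).
Hypothesis ciK : ci \in K.
Hypothesis cjK : cj \in K.
Hypothesis cij : ci != cj.
Hypothesis hu : home u = ci.
Hypothesis ucj : d u cj <= 2 * r.

Lemma merge_close w : home w = ci \/ home w = cj -> d w u <= 3 * r.
Proof.
have := home_le w; have := home_le u; have := r_gt0; rewrite hu => r0 uci lew [hw|hw].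
  by have := d_tri w ci u; rewrite (d_sym ci u); rewrite hw in lew; lra.
by have := d_tri w cj u; rewrite (d_sym cj u); rewrite hw in lew; have := ucj; lra.
Qed.

Lemma mergedP h x : x \in merged ci cj u h ->
  x = u \/ exists2 c, c \in others ci cj & x = h c.
Proof.
by rewrite !inE => /predU1P[->|/imsetP[c cO ->]]; [left|right; exists c].
Qed.

Lemma merged_u h : u \in merged ci cj u h. Proof. by rewrite !inE eqxx. Qed.

Lemma merged_h h c : c \in others ci cj -> h c \in merged ci cj u h.
Proof. by move=> cO; rewrite !inE imset_f ?orbT. Qed.

Lemma merged_home h x : transversal h -> x \in merged ci cj u h ->
  x = u \/ home x \in others ci cj.
Proof.
move=> hs /mergedP[->|[c cO ->]]; [by left|right].
by have [cK' _ _] := othersP _ _ _ cO; rewrite hs.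
Qed.

Lemma merged_card h : transversal h -> #|merged ci cj u h|.+1 = k.
Proof.
move=> hs; rewrite /merged cardsU1 (_ : (u \notin _) = true); last first.
  apply/imsetP=> -[c /othersP[cK' cci _] uE]; move: cci.
  by rewrite -(hs c cK') -uE hu eqxx.
rewrite card_in_imset; last first.
  move=> c c' /othersP[cK1 _ _] /othersP[cK2 _ _] eqh.
  by rewrite -(hs c cK1) eqh hs.
have cjD : cj \in K :\ ci by rewrite !inE eq_sym cij.
by rewrite add1n -cK (cardsD1 ci K) ciK (cardsD1 cj (K :\ ci)) cjD.
Qed.

Lemma home_cases w : [\/ home w = ci, home w = cj | home w \in others ci cj].
Proof.
have [->|wi] := eqVneq (home w) ci; first exact: Or31.
have [->|wj] := eqVneq (home w) cj; first exact: Or32.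
by apply: Or33; apply/othersP; split=> //; apply: homeK.
Qed.

Lemma merged_covers h : transversal h -> covers (merged ci cj u h).
Proof.
move=> hs w; have r0 := r_gt0; case: (home_cases w) => [hw|hw|hw].
- by exists u; [exact: merged_u|apply: merge_close; left].
- by exists u; [exact: merged_u|apply: merge_close; right].
exists (h (home w)); first exact: merged_h.
have := @cluster_diam (home w) w (h (home w)).
rewrite !inE eqxx hs ?homeK // eqxx => /(_ isT isT); lra.
Qed.

(** The point [w] reaches the cluster of [x] within [2 * r + r] and its own cluster within [2 * r],
    so it can replace [x] even when [x] is [u]. *)
Lemma merged_swap_covers h x w : transversal h -> x \in merged ci cj u h ->
  w \in cluster cj -> d w x < r -> covers (w |: merged ci cj u h :\ x).
Proof.
move=> hs xM wA wx p; have r0 := r_gt0.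
have [px|px] := eqVneq (home p) (home x).
  exists w; first by rewrite !inE eqxx.
  have := @cluster_diam (home x) p x; rewrite !inE px eqxx => /(_ isT isT).
  by have := d_tri p x w; rewrite (d_sym x w); lra.
case: (home_cases p) => [hp|hp|hp].
- exists u; last by apply: merge_close; left.
  by rewrite !inE eqxx andbT; apply/orP; right; apply: contraNneq px => <-; rewrite hu hp.
- exists w; first by rewrite !inE eqxx.
  have := @cluster_diam cj p w; rewrite wA inE hp eqxx => /(_ isT isT); lra.
exists (h (home p)).
  rewrite in_setU1 in_setD1 (merged_h h hp) andbT; apply/orP; right.
  by apply: contraNneq px => <-; rewrite hs ?homeK.
have := @cluster_diam (home p) p (h (home p)).
by rewrite !inE eqxx hs ?homeK // eqxx => /(_ isT isT); lra.
Qed.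

Lemma merged_disjoint h x :
  transversal h -> x \in merged ci cj u h -> x \notin cluster cj.
Proof.
move=> hs /(merged_home hs)[->|/othersP[_ _ xj]]; last by rewrite inE.
by rewrite inE hu.
Qed.

Hypothesis res_i : resilient (cluster ci).
Hypothesis res_j : resilient (cluster cj).

(** Points of the two clusters without a center closer than [r] are all sent to [u], so other
    centers receive from these clusters only points within [r]. The cell of [u] cannot recover two
    disjoint clusters, and a recovering center other than [u] lies outside both, which earns the
    successor in [central]. *)
Lemma extra_central h p : transversal h -> home p \in others ci cj ->
  p \notin merged ci cj u h ->
  exists x, [/\ x \in p |: merged ci cj u h, home x \in others ci cj
    & central (cluster ci) x || central (cluster cj) x].
Proof.
move=> hs hp pM; set X := p |: _.
have cX : #|X| = k by rewrite cardsU1 pM add1n merged_card.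
have covX : covers X.
  by move=> w; have [y yM le] := merged_covers hs w; exists y; rewrite // inE yM orbT.
have uX : u \in X by rewrite inE merged_u orbT.
have [g0 ag0] := assignment_ex covX.
pose g w := if [forall y in X, r <= d w y] && (home w \in [:: ci; cj]) then u else g0 w.
have ag : assignment X g.
  move=> w; rewrite /g; case: ifP => // /andP[/forall_inP far].
  rewrite !inE => hw; apply: allowed_far => //; apply: merge_close.
  by case/orP: hw => /eqP; [left|right].
have near w x : home w \in [:: ci; cj] -> g w = x -> x != u -> d w x < r.
  move=> hw gw xu; have [_ [[]|[far _]]] := allowed_cases (ag w); first by rewrite gw.
  by move: gw; rewrite /g hw; case: forall_inP => // _ /= uE; rewrite uE eqxx in xu.
have found c x : c \in [:: ci; cj] -> x \in X -> x != u ->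
    (#|cluster c :\: cell g x| + #|cell g x :\: cluster c| <= e)%N ->
    home x \in others ci cj /\ central (cluster c) x.
  move=> cij' xX xu le.
  have hx : home x \in others ci cj.
    move: xX; rewrite inE => /orP[|/(merged_home hs)[/eqP|//]].
      by rewrite inE => /eqP->.
    by rewrite (negPf xu).
  split=> //; have xc : x \notin cluster c.
    have [_ xi xj] := othersP _ _ _ hx; apply/clusterP=> xc.
    by move: cij'; rewrite !inE -xc (negPf xi) (negPf xj).
  have sub : (#|cluster c :&: cell g x| <= #|ball (cluster c) x|)%N.
    apply: subset_leq_card; apply/subsetP=> w; rewrite !inE => /andP[/eqP wc /eqP gw].
    by rewrite wc eqxx /= (near w) // wc.
  have := cell_outsider xc (allowed_center xX (ag x)); have := cell_in g (cluster c) x.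
  rewrite /central; move: le sub; clear; lia.
have [x xX lex] := res_i cX ag; have [y yX ley] := res_j cX ag.
have [xu|xu] := eqVneq x u; last first.
  have [|hx cx] := @found ci x _ xX xu lex; first by rewrite !inE eqxx.
  by exists x; split=> //; rewrite cx.
have [yu|yu] := eqVneq y u; last first.
  have [|hy cy] := @found cj y _ yX yu ley; first by rewrite !inE eqxx orbT.
  by exists y; split=> //; rewrite cy orbT.
exfalso; rewrite {}xu in lex; rewrite {}yu in ley.
have : (#|cluster ci| <= #|cluster ci :\: cell g u| + #|cell g u :\: cluster cj|)%N.
  rewrite -cardsUI; apply: leq_trans (leq_addr _ _); apply: subset_leq_card.
  apply/subsetP=> w; rewrite !inE => /eqP->; rewrite eqxx (negPf cij) /=.
  by case: (g w == u).
have := cluster_large ciK; move: lex ley; clear; lia.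
Qed.

(** Any center other than [q'] with the forced majority would, together with [q'], start the descent
    of [descent_false]. *)
Lemma extra_majority q q' : home q \in others ci cj -> home q' \in others ci cj ->
  q != q' -> central (cluster cj) q' ->
  exists X, [/\ q \in X, q' \in X
    & (#|cluster cj|.+1 - e <= #|forced_to (cluster cj) X q'|)%N].
Proof.
move=> hq hq' qq' cq'; have cA := cluster_large cjK; have r0 := r_gt0.
have qball_gt0 := majority_gt0 cA (majority_weak cq').
(* Centrality of [q'] forces [e > 0], so each cluster has more than two points. *)
have [o ho oq'] : exists2 o, home o = home q' & o != q'.
  have c2 : (1 < #|cluster (home q')|)%N.
    have := cluster_large (homeK q'); have := cq'.
    have := subset_leq_card (ball_sub (cluster cj) q'); rewrite /central; clear; lia.
  have := cardsD1 q' (cluster (home q')); rewrite inE eqxx /= => cD.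
  have /card_gt0P[o] : (0 < #|cluster (home q') :\ q'|)%N by move: c2 cD; clear; lia.
  by rewrite !inE => /andP[oq' /eqP ho]; exists o.
(* Unless [q] already represents the cluster of [q'], [o] does; thus [q'] is not yet a center and
   can take the free place. *)
pose h c := if c == home q then q else if c == home q' then o else c.
have hs : transversal h.
  move=> c cK'; rewrite /h; case: eqP => [->//|_]; case: eqP => [->//|_].
  exact: home_id.
have qM : q \in merged ci cj u h.
  by have := merged_h h hq; rewrite {1}/h eqxx.
have q'j : q' \notin cluster cj by have [_ _] := othersP _ _ _ hq'; rewrite inE.
have q'M : q' \notin merged ci cj u h.
  apply/negP=> /mergedP[q'u|[c cO q'c]].
    by have [_] := othersP _ _ _ hq'; rewrite q'u hu eqxx.
  have [cK' _ _] := othersP _ _ _ cO.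
  have cq : c = home q' by rewrite q'c hs.
  move: q'c; rewrite /h cq; case: eqP => [_ /esym/eqP|_ /esym/eqP]; first exact/negP.
  by rewrite eqxx; apply/negP.
set X := q' |: merged ci cj u h.
have qX : q \in X by rewrite in_setU1 qM orbT.
exists X; split=> //; first exact: setU11.
have cX : #|X| = k by rewrite cardsU1 q'M add1n merged_card.
have covX : covers X.
  by move=> w; have [y yM le] := merged_covers hs w; exists y; rewrite // inE yM orbT.
have diamA := @cluster_diam cj.
have uq' : u != q' by apply: contraNneq q'M => <-; apply: merged_u.
have alts x w : x \in X -> w \in cluster cj ->
    exists y, [/\ y \in X, y != x & d w y <= 3 * r].
  move=> xX wA; have [xu|xu] := eqVneq u x.
    exists q'; rewrite -xu eq_sym uq' !inE eqxx; split=> //.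
    exact: (serves_ball diamA qball_gt0).
  exists u; rewrite xu inE merged_u orbT; split=> //.
  by apply: merge_close; right; apply/clusterP.
have XA y : y \in X -> y \notin cluster cj.
  by rewrite inE => /orP[|/(merged_disjoint hs)//]; rewrite inE => /eqP->.
(* No center lies in [cluster cj], so [cj] fills both exceptional slots and the smaller bound never
   applies. *)
have [x xX xmaj] : exists2 x, x \in X &
   ((if x == cj then #|cluster cj| - e else #|cluster cj|.+1 - e)
     <= #|forced_to (cluster cj) X x|)%N.
  apply: (@forced_majority_weak (cluster cj) X cj cj) => //.
    by move=> y yX yA; have := XA y yX; rewrite yA.
  by rewrite eqxx.
have xcj : x != cj.
  by apply: contraNneq (XA x xX) => ->; apply/clusterP; apply: home_id.
rewrite (negPf xcj) in xmaj; have [<-//|xq'] := eqVneq x q'.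
have xM : x \in merged ci cj u h.
  by move: xX; rewrite inE => /orP[|//]; rewrite inE (negPf xq').
exfalso; have frE : frame (merged ci cj u h :\ x) q' x = X by rewrite /frame setD1K.
apply: (@descent_false (cluster cj) (merged ci cj u h :\ x) x q') => //.
- have := cardsD1 x (merged ci cj u h); rewrite xM /= => cD.
  by have := merged_card hs; move: cD; clear; lia.
- by move=> f; rewrite inE => /andP[_]; apply: merged_disjoint.
- by rewrite !inE eqxx.
- exact: merged_disjoint xM.
- by rewrite inE (negPf q'M) andbF.
- by rewrite eq_sym.
- by rewrite setD1K //; apply: merged_covers.
- by move=> w wA wx; apply: merged_swap_covers.
by rewrite frE.
Qed.

(** By [extra_majority] in both orders, each of the two has a forced majority while the other is a
    center; a common point contradicts [forced_excl]. *)
Lemma central_unique q q' : home q \in others ci cj -> home q' \in others ci cj ->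
  central (cluster cj) q -> central (cluster cj) q' -> q = q'.
Proof.
move=> hq hq' cq cq'; apply/eqP; apply: contraT => qq'.
have q'q : q' != q by rewrite eq_sym.
have [X [qX q'X majq']] := extra_majority hq hq' qq' cq'.
have [Y [q'Y qY majq]] := extra_majority hq' hq q'q cq.
have cA := cluster_large cjK.
have [|w /forced_toP[_ fw] /forced_toP[_ fw']] :=
  setI_witness (forced_to_sub (cluster cj) X q') (forced_to_sub (cluster cj) Y q).
  exact: ltnW (majority_sum cA (majority_weak majq') majq).
by case: (forced_excl fw fw' qX q'Y q'q).
Qed.

(** Without errors a cluster tolerates a single center, yet the free center could be placed at [p]
    beside [u]. *)
Lemma singleton_cluster p : e = 0%N -> home p = ci -> p = u.
Proof.
move=> e0 hp; apply/eqP; apply: contraT => pu.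
have idK : transversal id by exact: home_id.
have pM : p \notin merged ci cj u id.
  apply/negP=> /(merged_home idK)[/eqP|/othersP[_]]; first by rewrite (negPf pu).
  by rewrite hp eqxx.
case: (@too_many_centers (cluster ci) (p |: merged ci cj u id)) => //.
- by rewrite cardsU1 pM add1n merged_card.
- move=> w; have [y yM le] := merged_covers idK w.
  by exists y; rewrite // inE yM orbT.
rewrite e0; apply: (@leq_trans #|[set p; u]|); first by rewrite cards2 pu.
apply: subset_leq_card; apply/subsetP=> y; rewrite !inE.
by case/orP=> /eqP->; rewrite ?hp ?hu !eqxx ?orbT.
Qed.

(* A point of another cluster that is close to all of [cluster ci] lets two
   points of [cluster ci] stand in for its center, so three centers fit there. *)
Lemma not_central_one_error x : e = 1%N -> home x \in others ci cj ->
  central (cluster ci) x -> False.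
Proof.
(* With one error, centrality makes the ball the whole cluster. *)
move=> e1 hx; rewrite /central e1 subn1 /= => cx; have r0 := r_gt0.
have near a : a \in cluster ci -> d a x < r.
  have /eqP <- : ball (cluster ci) x == cluster ci by rewrite eqEcard ball_sub.
  by case/ballP.
have uA : u \in cluster ci by apply/clusterP.
have /card_gt1P[a [b []]] : (1 < #|cluster ci :\ u|)%N.
  have := cardsD1 u (cluster ci); rewrite uA; have := cluster_large ciK; rewrite e1.
  by clear; lia.
rewrite !in_setD1 => /andP[au aA] /andP[bu bA] ab.
set Y := u |: (a |: [set b]); set m := home x in hx.
have cY : #|Y| = 3%N.
  by rewrite !cardsU1 cards1 !inE (negPf ab) ![u == _]eq_sym (negPf au) (negPf bu).
have YA : Y \subset cluster ci.
  by apply/subsetP=> y; rewrite in_setU1 in_set2 => /or3P[] /eqP->.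
(* The three points of [Y] replace the centers [ci], [cj] and [m], so the total is again [k]. *)
case: (@too_many_centers (cluster ci) (Y :|: others ci cj :\ m)) => //.
- have cjD : cj \in K :\ ci by rewrite !inE eq_sym cij.
  have := cardsUI Y (others ci cj :\ m).
  rewrite (_ : Y :&: _ = set0); last first.
    apply/setP=> y; rewrite in_set0; apply/negP; rewrite inE => /andP[/(subsetP YA)].
    move/clusterP=> hy; rewrite in_setD1 => /andP[_ /othersP[yK yci _]].
    by rewrite -hy home_id // eqxx in yci.
  rewrite cards0 addn0 => ->; rewrite cY -cK (cardsD1 ci K) ciK.
  by rewrite (cardsD1 cj (K :\ ci)) cjD -/(others ci cj) (cardsD1 m (others ci cj)) hx.
- move=> w; case: (home_cases w) => [hw|hw|hw].
  + by exists u; [rewrite !inE eqxx|apply: merge_close; left].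
  + by exists u; [rewrite !inE eqxx|apply: merge_close; right].
  have [wm|wm] := eqVneq (home w) m.
    exists a; first by rewrite !inE eqxx !orbT.
    have := near a aA; have := @cluster_diam m w x; rewrite !inE wm eqxx => /(_ isT isT).
    by have := d_tri w x a; rewrite (d_sym x a); lra.
  exists (home w); last by have := home_le w; lra.
  by rewrite in_setU in_setD1 wm hw orbT.
rewrite e1 -cY; apply: subset_leq_card; apply/subsetP=> y yY.
by rewrite in_setI in_setU yY (subsetP YA).
Qed.

Lemma central_card_le1 :
  (#|[set x | (home x \in others ci cj) && central (cluster cj) x]| <= 1)%N.
Proof.
apply/card_le1_eqP=> q q'; rewrite in_set => /andP[hq cq].
by rewrite in_set => /andP[hq' cq']; apply: central_unique.
Qed.

End Merge.

(** * Separation of two resilient clusters *)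

Lemma othersC ci cj : others ci cj = others cj ci.
Proof. by apply/setP=> c; rewrite !inE andbCA. Qed.

Lemma resilient_clusters_far ci cj cm u v :
  ci \in K -> cj \in K -> ci != cj -> cm \in others ci cj ->
  resilient (cluster ci) -> resilient (cluster cj) ->
  home u = ci -> home v = cj -> (exists p, home p != p) -> r < d u v.
Proof.
move=> ciK cjK cij cmO res_i res_j hu hv [p0 p0K]; rewrite ltNge; apply/negP=> duv.
have ucj : d u cj <= 2 * r.
  by have := d_tri u v cj; have := home_le v; rewrite hv; lra.
have vci : d v ci <= 2 * r.
  by have := d_tri v u ci; have := home_le u; rewrite hu (d_sym v u); lra.
have cji : cj != ci by rewrite eq_sym.
have [cmK _ _] := othersP _ _ _ cmO.
have idK : transversal id by exact: home_id.
have p0NK : p0 \notin K by apply: contra p0K => /home_id->.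
(* Without errors no point is [central], but clusters may be singletons; the point [p0], not in [K],
   then takes the free place or contradicts [singleton_cluster]. *)
have [e0|e_gt0] := posnP e.
  case: (home_cases ci cj p0) => [hp|hp|hp].
  - have p0u := singleton_cluster ciK cjK cij hu ucj res_i e0 hp.
    have ciu := singleton_cluster ciK cjK cij hu ucj res_i e0 (home_id ciK).
    by rewrite hp ciu p0u eqxx in p0K.
  - have p0v := singleton_cluster cjK ciK cji hv vci res_j e0 hp.
    have cjv := singleton_cluster cjK ciK cji hv vci res_j e0 (home_id cjK).
    by rewrite hp cjv p0v eqxx in p0K.
  have p0M : p0 \notin merged ci cj u id.
    apply/negP=> /mergedP[p0u|[c /othersP[cK' _ _] p0c]].
      by have [_] := othersP _ _ _ hp; rewrite p0u hu eqxx.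
    by rewrite p0c /= cK' in p0NK.
  have [x [_ _]] := extra_central ciK cjK cij hu ucj res_i res_j idK hp p0M.
  rewrite /central e0 !subn0 => /orP[]; apply/negP; rewrite -leqNgt;
    exact/subset_leq_card/ball_sub.
(* With one error a cluster may have only three points, too few to avoid three given ones, so
   [not_central_one_error] is used instead. *)
have [e1|e_neq1] := eqVneq e 1%N.
  have [p hp pcm] : exists2 p, home p = cm & p != cm.
    have /card_gt0P[p] : (0 < #|cluster cm :\ cm|)%N.
      have := cardsD1 cm (cluster cm); have := cluster_large cmK; rewrite e1.
      by case: (cm \in _) => /=; clear; lia.
    by rewrite !inE => /andP[pcm /eqP hp]; exists p.
  have pM : p \notin merged ci cj u id.
    apply/negP=> /mergedP[pu|[c /othersP[cK' _ _] pc]].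
      by have [_] := othersP _ _ _ cmO; rewrite -hp pu hu eqxx.
    by move: hp; rewrite pc /= home_id // => cE; rewrite pc /= cE eqxx in pcm.
  have hpO : home p \in others ci cj by rewrite hp.
  have [x [_ hx /orP[cx|cx]]] := extra_central ciK cjK cij hu ucj res_i res_j idK hpO pM.
    exact: (@not_central_one_error ci cj u ciK cjK cij hu ucj res_i x e1 hx cx).
  rewrite othersC in hx.
  exact: (@not_central_one_error cj ci v cjK ciK cji hv vci res_j x e1 hx cx).
(* For [e >= 2] clusters have at least five points, enough to avoid the at most two [central] points
   and also [h cm]. *)
pose B c c' := [set x | (home x \in others c c') && central (cluster c') x].
have B_le2 : (#|B ci cj :|: B cj ci| <= 2)%N.
  apply: leq_trans (leq_card_setU _ _) _; rewrite (leq_add (n1 := 1) (n2 := 1)) //.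
    exact: central_card_le1 ciK cjK cij hu ucj res_j.
  exact: central_card_le1 cjK ciK cji hv vci res_i.
have avoid (D : {set S}) c : (#|D| <= 3)%N -> c \in K ->
    exists2 y, home y = c & y \notin D.
  move=> D3 cK'; have /card_gt0P[y] : (0 < #|cluster c :\: D|)%N.
    have := cardsID D (cluster c); have := subset_leq_card (subsetIr (cluster c) D).
    have := cluster_large cK'; move: D3 e_gt0 e_neq1; clear; lia.
  by rewrite !inE => /andP[yD /eqP hy]; exists y.
pose h c := odflt c [pick y | (home y == c) && (y \notin B ci cj :|: B cj ci)].
have hP c : c \in K -> home (h c) = c /\ h c \notin B ci cj :|: B cj ci.
  move=> cK'; rewrite /h; case: pickP => [y /andP[/eqP]//|no].
  have [|y hy yB] := avoid (B ci cj :|: B cj ci) c _ cK'; first exact: leq_trans B_le2 _.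
  by have := no y; rewrite hy eqxx yB.
have hs : transversal h by move=> c /hP[].
have [|p hp] := avoid (h cm |: (B ci cj :|: B cj ci)) cm _ cmK.
  by rewrite cardsU1; move: B_le2; case: (_ \notin _) => /=; clear; lia.
rewrite in_setU1 negb_or => /andP[phcm pB].
have pM : p \notin merged ci cj u h.
  apply/negP=> /mergedP[pu|[c /othersP[cK' _ _] pc]].
    by have [_] := othersP _ _ _ cmO; rewrite -hp pu hu eqxx.
  by move: hp; rewrite pc hs // => cE; rewrite pc cE eqxx in phcm.
have hpO : home p \in others ci cj by rewrite hp.
have [x [xX hx cx]] := extra_central ciK cjK cij hu ucj res_i res_j hs hpO pM.
have xB : x \in B ci cj :|: B cj ci.
  have hx' : home x \in others cj ci by rewrite othersC.
  by rewrite in_setU [x \in B ci cj]in_set [x \in B cj ci]in_set hx hx' orbC.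
suff : x \notin B ci cj :|: B cj ci by rewrite xB.
move: xX; rewrite in_setU1 => /orP[/eqP->//|/mergedP[xu|[c /othersP[cK' _ _] ->]]].
  by have [_] := othersP _ _ _ hx; rewrite xu hu eqxx.
by have [] := hP c cK'.
Qed.

End Clusters.

End ForcedAssignments.

(** * From perturbations of the metric to assignments *)

Lemma cost_far_point (R : realType) (S : finType) (d : S -> S -> R)
    (X : {set S}) (r : R) : 0 < r -> r <= cost d X ->
  exists w, forall x, x \in X -> r <= d w x.
Proof.
move=> r_gt0 ler.
have [/existsP[w /forall_inP far]|] := boolP [exists w, [forall x in X, r <= d w x]].
  by exists w.
rewrite negb_exists => /forallP noW; suff : cost d X < r by rewrite ltNge ler.
apply/bigmax_ltP; split=> // w _; have /forall_inPn[x xX] := noW w.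
rewrite -ltNge; apply: le_lt_trans.
by have [_] := @minvalP _ _ [pred x | x \in X] (d w) x xX; apply.
Qed.

Lemma opt_radius_le (R : realType) (S : finType) (d : S -> S -> R) (k : nat)
    (X : {set S}) : #|X| = k -> opt_radius d k <= cost d X.
Proof.
move=> cX; have PX : [pred X : {set S} | #|X| == k] X by rewrite /= cX.
by have [_] := minvalP (cost d) PX; apply.
Qed.

(* Distances of at least the optimal radius [r] become at least [3 r], so no
   [k] centers beat [X], while every point can be sent to an allowed center. *)
Lemma locally_resilient_assignments (R : realType) (S : finType)
    (d : S -> S -> R) (k e : nat) (eps : R) (A : {set S}) :
  is_metric d -> 0 < opt_radius d k -> eps * #|S|%:R < e.+1%:R ->
  locally_perturbation_resilient d k 3 eps A ->
  resilient d k e (opt_radius d k) A.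
Proof.
case=> d_ge0 _ _ _; set r := opt_radius d k => r_gt0 lte lpr X g cX ag.
(* For [w] with a center closer than [r], [g w] is at most three times as far as any center, so
   tripling the other distances makes it closest. Otherwise its distance lies between [r] and
   [3 * r] and may be raised to exactly [3 * r]. *)
pose d' w y := if y == g w
  then (if [exists z in X, d w z < r] then d w y else 3 * r) else 3 * d w y.
have gX w : g w \in X by have [] := allowed_cases (ag w).
have caseg w : (d w (g w) < r /\ [exists z in X, d w z < r] /\
                 forall y, y \in X -> d w (g w) <= 3 * d w y) \/
    ([exists z in X, d w z < r] = false /\ (forall y, y \in X -> r <= d w y) /\
     d w (g w) <= 3 * r).
  have [gwX [[near le3]|[far le3]]] := allowed_cases (ag w); [left|right].
    by split=> //; split=> //; apply/exists_inP; exists (g w).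
  split; last by split.
  apply/negbTE/negP=> /exists_inP[z zX].
  by have := far z zX; rewrite leNgt => /negPf->.
have pert : perturbation 3 d d'.
  move=> w y; have dwy := d_ge0 w y; rewrite /d'; case: eqP => [yE|_]; last first.
    by split; last (apply/andP; split); lra.
  rewrite yE; case: (caseg w) => [[near [-> _]]|[-> [far le3]]].
    by rewrite yE in dwy; split; last (apply/andP; split); lra.
  by have := far _ (gX w); split; last (apply/andP; split); lra.
have d'g w : d' w (g w) <= 3 * r.
  by rewrite /d' eqxx; case: (caseg w) => [[near [-> _]]|[-> _]]; lra.
have d'min w y : y \in X -> d' w (g w) <= d' w y.
  move=> yX; rewrite /d' eqxx; case: eqP => [->//|_].
  case: (caseg w) => [[_ [-> le3]]|[-> [far _]]]; first exact: le3.
  by have := far y yX; lra.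
have d'far w y : r <= d w y -> 3 * r <= d' w y.
  move=> wy; rewrite /d'; case: eqP => [yE|_]; last by lra.
  by move: wy; rewrite yE; case: (caseg w) => [[near _]|[-> _]] wy; lra.
have cost_ge (Y : {set S}) : #|Y| = k -> 3 * r <= cost d' Y.
  move=> cY; have [w far] := cost_far_point r_gt0 (opt_radius_le d cY).
  have /card_gt0P[y yY] : (0 < #|Y|)%N by rewrite cY -cX; apply/card_gt0P; exists (g w).
  have [[z zY minE] _] := @minvalP _ _ [pred x | x \in Y] (d' w) y yY.
  apply: le_trans (d'far w z (far z zY)) _; rewrite -minE.
  exact: (@le_bigmax _ _ _ _ (fun v => minval [pred x | x \in Y] (d' v))).
have cost_X : cost d' X = opt_radius d' k.
  apply/le_anti/andP; split; last exact: opt_radius_le.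
  have PX : [pred X : {set S} | #|X| == k] X by rewrite /= cX.
  have [[Y /eqP cY optE] _] := minvalP (cost d') PX; rewrite /opt_radius optE.
  apply: le_trans _ (cost_ge Y cY); apply/bigmax_leP; split; first by lra.
  move=> w _; apply: le_trans _ (d'g w).
  have [_ mle] := @minvalP _ _ [pred x | x \in X] (d' w) (g w) (gX w).
  exact: mle (gX w).
have opt : optimal_clustering d' k [set [set v | g v == x] | x in X].
  by exists X; [split|exists g => // w; split=> // y; apply: d'min].
have [B /imsetP[x xX ->] close] := lpr d' pert _ opt.
exists x => //; rewrite -ltnS -(ltr_nat R); exact: le_lt_trans close lte.
Qed.

Theorem theorem4 (R : realType) (S : finType) (d : S -> S -> R) (k : nat)
    (eps : R) (C : {set {set S}})
    (d_metric : is_metric d)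
    (eps_gt0 : 0 < eps)
    (C_opt : optimal_clustering d k C)
    (C_large : forall A : {set S}, A \in C -> 2 * eps * #|S|%:R < #|A|%:R)
    (three_lpr : exists D : {set {set S}},
       [/\ D \subset C, (3 <= #|D|)%N
         & forall A : {set S}, A \in D ->
             locally_perturbation_resilient d k 3 eps A]) :
  forall Ci Cj : {set S}, Ci \in C -> Cj \in C -> Ci != Cj ->
    locally_perturbation_resilient d k 3 eps Ci ->
    locally_perturbation_resilient d k 3 eps Cj ->
    forall u v : S, u \in Ci -> v \in Cj -> opt_radius d k < d u v.
Proof.
move=> Ci Cj CiC CjC Cij lpr_i lpr_j u v uCi vCj.
have [d_ge0 d_eq0 d_sym d_tri] := d_metric.
have [K [cK costK] [f fP CE]] := C_opt.
have d_refl x : d x x = 0 by apply/d_eq0.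
have d_sep x y : x != y -> 0 < d x y.
  by move=> xy; rewrite lt_neqAle d_ge0 andbT eq_sym; apply: contraNneq xy => /d_eq0->.
have fK w : f w \in K by have [] := fP w.
have f_id c : c \in K -> f c = c.
  move=> cK'; apply/esym/d_eq0/le_anti; rewrite d_ge0 andbT -(d_refl c).
  by have [_ /(_ c cK')] := fP c.
set r := opt_radius d k.
have f_le w : d w (f w) <= r.
  have [[x xK minE] _] := @minvalP _ _ [pred x | x \in K] (d w) (f w) (fK w).
  have [_ /(_ x xK)] := fP w; rewrite -minE => /le_trans; apply.
  rewrite /r -costK.
  exact: (@le_bigmax _ _ _ _ (fun v => minval [pred x | x \in K] (d v))).
have clusterE (A : {set S}) : A \in C -> exists2 c, c \in K & A = cluster f c.
  by rewrite CE => /imsetP[c cK' ->]; exists c.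
have [ci ciK CiE] := clusterE _ CiC; have [cj cjK CjE] := clusterE _ CjC.
have hu : f u = ci by apply/clusterP; rewrite -CiE.
have hv : f v = cj by apply/clusterP; rewrite -CjE.
have cij : ci != cj by apply: contraNneq Cij => cE; rewrite CiE CjE cE.
(* For [r <= 0] it is enough that points of different clusters are distinct. *)
have [r_gt0|r_le0] := ltP 0 r; last first.
  apply: le_lt_trans r_le0 _; apply: d_sep; apply: contraNneq cij => uv.
  by rewrite -hu -hv uv.
(* Error counts are integers, so the real bound may be truncated; the size hypothesis then gives
   more than [2 * e] points per cluster. *)
pose e := Num.trunc (eps * #|S|%:R).
have epsn_ge0 : 0 <= eps * #|S|%:R by rewrite mulr_ge0 ?ler0n // ltW.
have /andP[e_le e_lt] := truncn_itv epsn_ge0; rewrite -/e in e_le e_lt.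
have large c : c \in K -> (2 * e < #|cluster f c|)%N.
  move=> cK'; have AC : cluster f c \in C by rewrite CE; apply/imsetP; exists c.
  have := C_large _ AC; rewrite -(ltr_nat R) natrM -mulrA; apply: le_lt_trans.
  by rewrite ler_pM2l // ltr0n.
have [cm cmO] : exists cm, cm \in others K ci cj.
  have [D [/subsetP DC D3 _]] := three_lpr.
  have /card_gt0P[A] : (0 < #|D :\: [set Ci; Cj]|)%N.
    have I2 : (#|D :&: [set Ci; Cj]| <= 2)%N.
      apply: leq_trans (subset_leq_card (subsetIr _ _)) _.
      by rewrite cards2; case: (_ != _).
    rewrite -(cardsID [set Ci; Cj] D) in D3.
    by rewrite -(ltn_add2l #|D :&: [set Ci; Cj]|) addn0 (leq_ltn_trans I2).
  rewrite !inE negb_or => /andP[/andP[Ai Aj] /DC/clusterE[cm cmK AE]].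
  exists cm; apply/othersP; split=> //.
    by apply: contraNneq Ai => cE; rewrite AE cE -CiE.
  by apply: contraNneq Aj => cE; rewrite AE cE -CjE.
(* Since [r > 0], a point at distance at least [r] from all centers is not a center. *)
have nonctr : exists p, f p != p.
  have [w far] : exists w, forall x, x \in K -> r <= d w x.
    by apply: cost_far_point => //; rewrite costK.
  exists w; apply: contraTneq r_gt0 => fw; rewrite -leNgt -(d_refl w) -{2}fw.
  exact: far.
apply: (@resilient_clusters_far R S d k e r d_ge0 d_refl d_sep d_sym d_tri r_gt0
  K f cK fK f_id f_le large ci cj cm u v) => //; rewrite -?CiE -?CjE;
  exact: locally_resilient_assignments e_lt _.
Qed.
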